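(* There is an absolute constant $c>0$ such that for every $\phi\ge1$ there exists a $\phi$-smooth instance $\mathcal{I}$ of scheduling on unrestricted related machines with \[ \mathbb{E}_{I\sim\mathcal{I}}\left[\max_{\sigma\in \mathrm{Jump}(I)}\frac{C_{\max}(I,\sigma)}{C^*_{\max}(I)}\right]\ge c\,\phi . \]
   Context: Scheduling on unrestricted related machines: machines $M=\{1,\dots,m\}$ with speeds $s_1\ge\dots\ge s_m=1$, jobs $J=\{1,\dots,n\}$ with processing requirements $p_j\ge0$; job $j$ on machine $i$ takes time $p_j/s_i$. A schedule $\sigma$ assigns each job to a machine; $J_i(\sigma)$ is the set of jobs on $i$, $L_i(\sigma)=\sum_{j\in J_i(\sigma)}p_j/s_i$, $C_{\max}(I,\sigma)=\max_i L_i(\sigma)$, and $C^*_{\max}(I)$ is the minimum makespan. A machine $i$ is critical if $L_i(\sigma)=C_{\max}(I,\sigma)$. $\sigma$ is jump optimal if for every critical machine $i$, every job $j\in J_i(\sigma)$ and every $i'\neq i$: $L_{i'}(\sigma)+p_j/s_{i'}\ge L_i(\sigma)$; $\mathrm{Jump}(I)$ is the set of jump optimal schedules. A $\phi$-smooth instance $\mathcal{I}$ consists of a choice of $m$, speeds $s_1\ge\dots\ge s_m=1$, $n$, and for each job $j$ a density $f_j:[0,1]\to[0,\phi]$; the $p_j$ are drawn independently according to the $f_j$, yielding the random instance $I\sim\mathcal{I}$. (The paper states the result as an $\Omega(\phi)$ lower bound.) *)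

(* Defs.v *)
From HB Require Import structures.
From mathcomp Require Import all_boot all_order all_algebra.
From mathcomp Require Import all_classical all_reals all_analysis.
From mathcomp Require Import measurable_realfun.

Set Implicit Arguments.
Unset Strict Implicit.
Unset Printing Implicit Defensive.

Import Order.TTheory GRing.Theory Num.Theory.
Import numFieldNormedType.Exports.

Local Open Scope classical_set_scope.
Local Open Scope ring_scope.

(* The machines are 'I_m.+1, so that there is at least one: the classical number
   of machines is m.+1, and the slowest one (of speed 1) is ord_max. *)
Section Schedules.
Context {R : realType} {m n : nat}.
Variables (s : 'I_m.+1 -> R) (p : n.-tuple R).

Definition schedule : finType := {ffun 'I_n -> 'I_m.+1}.

Definition load (sg : schedule) (i : 'I_m.+1) : R :=
  \sum_(j | sg j == i) tnth p j / s i.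

(* The initial value of the iterated max is one of the loads, so this is the
   exact maximum; the same remark applies to the minimum in opt_makespan. *)
Definition makespan (sg : schedule) : R :=
  \big[Num.max/load sg ord0]_(i < m.+1) load sg i.

Definition opt_makespan : R :=
  \big[Num.min/makespan [ffun=> ord0]]_(sg : schedule) makespan sg.

Definition critical (sg : schedule) (i : 'I_m.+1) : bool :=
  load sg i == makespan sg.

Definition jump_optimal (sg : schedule) : bool :=
  [forall i, critical sg i ==>
    [forall j, (sg j == i) ==>
      [forall i', (i' != i) ==>
        (load sg i <= load sg i' + tnth p j / s i')]]].

(* For nonnegative p the set of jump optimal schedules is nonempty and all
   ratios are nonnegative, so the initial value 0 does not affect the maximum.
   The ratio reads 0 / 0 = 0 when all the p_j vanish, which is a null event
   for the random instances below as soon as there is a job. *)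
Definition max_jump_ratio : R :=
  \big[Num.max/0]_(sg : schedule | jump_optimal sg)
    (makespan sg / opt_makespan).

End Schedules.

(* A probability density [0, 1] -> [0, phi]; its values outside of [0, 1] are
   irrelevant. *)
Record density (R : realType) (phi : R) := Density {
  density_fun :> R -> R ;
  density_measurable : measurable_fun `[(0 : R), 1] density_fun ;
  density_bounds : forall x, x \in `[0, 1] -> 0 <= density_fun x <= phi ;
  density_int1 :
    (\int[lebesgue_measure]_(x in `[0%R, 1%R]) (density_fun x)%:E = 1)%E }.

Section density_prob.
Context {R : realType} {phi : R}.
Variable f : density phi.
Local Open Scope ereal_scope.

Definition density_prob (A : set R) : \bar R :=
  \int[lebesgue_measure]_(x in A `&` `[0%R, 1%R]) (f x)%:E.

Let density_prob0 : density_prob set0 = 0.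
Proof. by rewrite /density_prob set0I integral_set0. Qed.

Let density_prob_ge0 A : 0 <= density_prob A.
Proof.
apply: integral_ge0 => x [_ /= x01].
by rewrite lee_fin; have /andP[] := density_bounds f x01.
Qed.

Let density_prob_sigma_additive : semi_sigma_additive density_prob.
Proof.
move=> /= F mF tF mUF; rewrite /density_prob; apply: cvg_toP.
  apply: ereal_nondecreasing_is_cvgn => k l kl.
  by apply: lee_sum_nneg_natr => // i _ _; exact: density_prob_ge0.
have mF' k : measurable (F k `&` `[0%R, 1%R] : set (measurableTypeR R)).
  by apply: measurableI => //; exact: mF.
rewrite setI_bigcupl ge0_integral_bigcup//=.
- apply: measurable_funS (_ : measurable_fun (`[0%R, 1%R] : set R) _) => //.
    by move=> x [k _ []].
  apply/measurable_EFinP; exact: (density_measurable f).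
- by move=> x [k _ [_ /= x01]]; rewrite lee_fin;
    have /andP[] := density_bounds f x01.
- exact: trivIset_setIr.
Qed.

HB.instance Definition _ := isMeasure.Build _ _ _ density_prob
  density_prob0 density_prob_ge0 density_prob_sigma_additive.

Let density_prob_setT : density_prob [set: R] = 1.
Proof. by rewrite /density_prob setTI density_int1. Qed.

HB.instance Definition _ := @Measure_isProbability.Build _ _ R
  density_prob density_prob_setT.

End density_prob.

Section tuple_prob.
Context {d} {T : measurableType d} {R : realType}.

Definition tcons n (x : T * n.-tuple T) : n.+1.-tuple T :=
  [the n.+1.-tuple T of x.1 :: x.2].

Let measurable_tcons n : measurable_fun [set: T * n.-tuple T] (@tcons n).
Proof. by apply: measurable_cons. Qed.

HB.instance Definition _ n := isMeasurableFun.Build _ _ _ _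
  (@tcons n) (@measurable_tcons n).

(* The joint law of n independent variables with laws mu_0, ..., mu_(n-1),
   characterized by tuple_probE below. *)
Fixpoint tuple_prob n :
    ('I_n -> probability T R) -> probability (n.-tuple T) R :=
  if n is n'.+1 then fun mu =>
    distribution (mu ord0 \x tuple_prob (fun j => mu (lift ord0 j)))%E
      (@tcons n')
  else fun=> \d_([tuple]).

Lemma tuple_probE n (mu : 'I_n -> probability T R) (A : 'I_n -> set T) :
  (forall j, measurable (A j)) ->
  tuple_prob mu [set x | forall j, A j (tnth x j)] =
  (\prod_(j < n) mu j (A j))%E.
Proof.
elim: n mu A => [|n IHn] mu A mA /=.
  rewrite big_ord0 diracE; case: (boolP (_ \in _)) => //.
  by move/negP; rewrite inE; case=> -[].
rewrite big_ord_recl -(IHn _ (fun j => A (lift ord0 j)))// -product_measure1E//.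
- rewrite /distribution /pushforward; congr (_ _).
  apply/seteqP; split => -[x y] /=.
    move=> Ay; split=> [|j]; first exact: (Ay ord0).
    by have := Ay (lift ord0 j); rewrite tnthS.
  move=> [Ax Ay] j; case: (unliftP ord0 j) => [k ->|->]; last exact: Ax.
  by rewrite tnthS; exact: Ay.
- rewrite (_ : [set x | _] = \bigcap_(j in [set: 'I_n])
      ((fun x : n.-tuple T => tnth x j) @^-1` A (lift ord0 j))).
    apply: fin_bigcap_measurable => // j _; rewrite -[X in measurable X]setTI.
    exact: measurable_tnth.
  by apply/seteqP; split => x /= Ax j; [move=> _|]; apply: Ax.
Qed.

End tuple_prob.

Record smooth_instance (R : realType) (phi : R) := SmoothInstance {
  si_m : nat ;
  si_speed : 'I_si_m.+1 -> R ;
  si_speed_noninc : forall i i' : 'I_si_m.+1,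
    (i <= i')%N -> si_speed i' <= si_speed i ;
  si_speed_last : si_speed ord_max = 1 ;
  si_n : nat ;
  si_density : 'I_si_n -> density phi }.

Arguments si_speed {R phi} s _.
Arguments si_density {R phi} s _.

Definition processing_law (R : realType) (phi : R) (I : smooth_instance phi) :
    probability ((si_n I).-tuple R) R :=
  tuple_prob (fun j => density_prob (si_density I j)).

(* Main.v *)
(* One machine has speed phi, all the others have speed 1. The big job p_0 lies
   in ]1/2, 1] and makes its slow machine critical; about phi^2 small jobs, of
   size in ]1/phi, 2/phi], serve to fill the fast machine until the big job
   cannot profit from jumping there, which takes only (phi - 1) p_0 of work;
   each remaining small job is alone on its slow machine. With the big job on
   the fast machine and each small job alone on a slow one, the makespan is at
   most 2/phi. All these bounds hold with probability one. For phi < 4 the small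
   jobs would not be short enough, but a single job has ratio 1. *)
Require Import Defs.
From mathcomp Require Import all_boot all_order all_algebra.
From mathcomp Require Import all_classical all_reals all_analysis.
From mathcomp Require Import measurable_realfun lra.
Import Order.TTheory GRing.Theory Num.Theory.
Local Open Scope ring_scope.

(** * Bounding the worst jump ratio by a pair of schedules *)

Section Ratio.
Context {R : realType} {m n : nat}.
Variables (s : 'I_m.+1 -> R) (p : n.-tuple R).

Lemma load_le_makespan (sg : schedule) (i : 'I_m.+1) :
  load s p sg i <= makespan s p sg.
Proof. exact: le_bigmax. Qed.

Lemma makespan_le (sg : @schedule m n) (x : R) :
  (forall i, load s p sg i <= x) -> makespan s p sg <= x.
Proof. by move=> sgx; apply: bigmax_le => [|i _]; exact: sgx. Qed.

Lemma makespan_gt0 (sg : @schedule m n) (j : 'I_n) :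
  (forall i, 0 < s i) -> (forall k, 0 <= tnth p k) -> 0 < tnth p j ->
  0 < makespan s p sg.
Proof.
move=> s0 p0 pj0; apply: lt_le_trans (load_le_makespan sg (sg j)).
rewrite /load (bigD1 j)//= ltr_pwDl ?divr_gt0//.
by apply: sumr_ge0 => k _; rewrite divr_ge0// ltW.
Qed.

Lemma max_jump_ratio_ge0 : 0 <= max_jump_ratio s p.
Proof. exact: bigmax_ge_id. Qed.

(** The positive job [j] makes every makespan positive, hence also the optimum, so dividing by it is
    legitimate; [tau] bounds the optimum from above. *)
Lemma max_jump_ratio_ge (sg tau : @schedule m n) (j : 'I_n) (a b : R) :
  (forall i, 0 < s i) -> (forall k, 0 <= tnth p k) -> 0 < tnth p j ->
  jump_optimal s p sg -> a <= makespan s p sg -> makespan s p tau <= b ->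
  0 <= a -> a / b <= max_jump_ratio s p.
Proof.
move=> s0 p0 pj0 sgJ asg taub a0.
have opt_gt0 : 0 < opt_makespan s p.
  by apply: lt_bigmin => [|ta _]; exact: makespan_gt0 pj0.
have optb : opt_makespan s p <= b by apply: le_trans taub; exact: bigmin_le.
apply: (@le_trans _ _ (makespan s p sg / opt_makespan s p)); last first.
  exact: (@le_bigmax_cond _ _ _ _ sg _ (fun sg => makespan s p sg / _)).
by apply: ler_pM => //; rewrite ?invr_ge0 ?lef_pV2 ?posrE ?(lt_le_trans opt_gt0)//
  ltW// (lt_le_trans opt_gt0).
Qed.

End Ratio.

(** * Deterministic analysis of one fast machine among slow ones *)

Section OneFastMachine.
Context {R : realType}.
Variable s : R.

Definition fast_speed {N : nat} (i : 'I_N.+2) : R := if i == ord0 then s else 1.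

(* Job [j] has the slow machine [lift ord0 j] for itself; the jobs in [K] are
   put on the fast machine instead. *)
Definition fast_schedule {N : nat} (K : {pred 'I_N.+1}) : @schedule N.+1 N.+1 :=
  [ffun j => if K j then ord0 else lift ord0 j].

Lemma load_fast {N} (p : N.+1.-tuple R) (K : {pred 'I_N.+1}) :
  load fast_speed p (fast_schedule K) ord0 = (\sum_(j | K j) tnth p j) / s.
Proof.
rewrite /load /fast_speed eqxx mulr_suml; apply: eq_bigl => j.
by rewrite ffunE; case: ifP => //; rewrite eq_sym (negbTE (neq_lift _ _)).
Qed.

Lemma load_slow {N} (p : N.+1.-tuple R) (K : {pred 'I_N.+1}) j :
  load fast_speed p (fast_schedule K) (lift ord0 j) =
  if K j then 0 else tnth p j.
Proof.
have E k : (fast_schedule K k == lift ord0 j) = (k == j) && ~~ K j.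
  rewrite ffunE; case: ifP => Kk.
    rewrite (negbTE (neq_lift _ _)); case: eqVneq => // kj.
    by rewrite -kj Kk.
  rewrite (inj_eq lift_inj); case: eqVneq => // kj.
  by rewrite -kj Kk.
rewrite /load /fast_speed eq_sym (negbTE (neq_lift _ _)).
under eq_bigr do rewrite divr1.
under eq_bigl do rewrite E.
case: (K j) => /=; first by rewrite big1// => k; rewrite andbF.
by under eq_bigl do rewrite andbT; rewrite big_pred1_eq.
Qed.

(* Greedily filling the fast machine: the last job added is shorter than
   [p_0], so the work does not overshoot an interval of length [p_0]. *)
Lemma exists_fast_jobs {N} (p : N.+1.-tuple R) : 1 <= s ->
  (forall j, j != ord0 -> 0 <= tnth p j < tnth p ord0) -> 0 < tnth p ord0 ->
  (s - 1) * tnth p ord0 <= \sum_(j | j != ord0) tnth p j ->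
  exists2 K : {pred 'I_N.+1}, ~~ K ord0 &
    (s - 1) * tnth p ord0 <= \sum_(j | K j) tnth p j < s * tnth p ord0.
Proof.
move=> s1 pj p0 Hs.
pose K k : {pred 'I_N.+1} := fun j => (j != ord0) && (j <= k)%N.
have exK : exists k, (s - 1) * tnth p ord0 <= \sum_(j | K k j) tnth p j.
  exists N; rewrite (eq_bigl (fun j => j != ord0))// => j.
  by rewrite /K -ltnS ltn_ord andbT.
case: (ex_minnP exK) => k kP kmin; exists (K k) => //.
(* [K 0] is empty because job 0 is excluded, so its sum is 0. *)
rewrite kP/=; case: k => [|k] in kP kmin *.
  rewrite big1 ?mulr_gt0// ?(lt_le_trans ltr01)// => j /andP[+].
  by rewrite leqn0 => /eqP j0 /eqP j0'; case: j0; exact: val_inj.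
have : \sum_(j | K k j) tnth p j < (s - 1) * tnth p ord0.
  by rewrite ltNge; apply/negP => /kmin; rewrite ltnn.
have [kN|Nk] := ltnP k.+1 N.+1.
  pose j0 := Ordinal kN.
  rewrite [X in _ -> X < _](bigD1 j0)/=; last by rewrite /K/= leqnn.
  rewrite (eq_bigl (K k)); last first.
    move=> j; rewrite /K -andbA; congr (_ && _).
    by rewrite -(inj_eq val_inj)/= andbC -ltn_neqAle.
  have /pj/andP[_] : j0 != ord0 by [].
  by rewrite mulrBl mul1r; lra.
(* No job has index [k.+1] here, so [K k] and [K k.+1] select the same jobs, and minimality of
   [k.+1] contradicts [kP]. *)
rewrite (eq_bigl (K k.+1)); first by move: kP; lra.
move=> j; rewrite /K -[in LHS]ltnS -[in RHS]ltnS.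
by rewrite (leq_trans (ltn_ord j))// (leq_trans (ltn_ord j) (leqW Nk)).
Qed.

(** The upper bound on the work of [K] keeps the load of the fast machine below [p_0], so only the
    slow machine of job 0 is critical. The lower bound says that after a jump of job 0 the fast
    machine would have load at least [p_0]. *)
Lemma jump_optimal_fast {N} (p : N.+1.-tuple R) (K : {pred 'I_N.+1}) :
  1 <= s -> ~~ K ord0 ->
  (forall j, j != ord0 -> 0 <= tnth p j < tnth p ord0) -> 0 < tnth p ord0 ->
  (s - 1) * tnth p ord0 <= \sum_(j | K j) tnth p j < s * tnth p ord0 ->
  jump_optimal fast_speed p (fast_schedule K).
Proof.
move=> s1 K0 pj p0 /andP[Kge Klt].
have s0 : 0 < s by exact: lt_le_trans s1.
have p_ge0 j : 0 <= tnth p j.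
  by have [->|/pj/andP[]//] := eqVneq j ord0; exact: ltW.
set L := load fast_speed p (fast_schedule K).
have L1 : L (lift ord0 ord0) = tnth p ord0 by rewrite /L load_slow (negbTE K0).
have Llt i : i != lift ord0 ord0 -> L i < tnth p ord0.
  case: (unliftP ord0 i) => [j|] -> i0; last by rewrite /L load_fast ltr_pdivrMr// mulrC.
  rewrite /L load_slow; case: ifP => // _.
  by have /pj/andP[] : j != ord0 by apply: contraNneq i0 => ->.
have L_ge0 i : 0 <= L i.
  rewrite /L /load; apply: sumr_ge0 => j _; rewrite divr_ge0// /fast_speed.
  by case: ifP => // _; exact: ltW.
apply/forallP => i; apply/implyP => /eqP critL.
have {}critL : i = lift ord0 ord0.
  apply/eqP/negPn/negP => /Llt; rewrite /L critL ltNge -L1.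
  by rewrite load_le_makespan.
subst i; apply/forallP => j; apply/implyP => /eqP sgj.
have -> : j = ord0.
  move: sgj; rewrite ffunE; case: ifP => [_ /eqP|_ /lift_inj//].
  by rewrite (negbTE (neq_lift _ _)).
apply/forallP => i'; apply/implyP => _; rewrite -/(L _) -/(L _) L1.
rewrite /fast_speed; case: eqVneq => [->|_]; last by rewrite divr1 lerDr.
by rewrite /L load_fast -mulrDl ler_pdivlMr// mulrC; lra.
Qed.

Lemma max_jump_ratio_fast_ge {N} (p : N.+1.-tuple R) (b : R) :
  1 <= s -> 0 < tnth p ord0 ->
  (forall j, j != ord0 -> 0 <= tnth p j < tnth p ord0) ->
  (s - 1) * tnth p ord0 <= \sum_(j | j != ord0) tnth p j ->
  tnth p ord0 / s <= b -> (forall j, j != ord0 -> tnth p j <= b) ->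
  tnth p ord0 / b <= max_jump_ratio (fast_speed (N := N)) p.
Proof.
move=> s1 p0 pj psum p0b pjb.
have s0 : 0 < s by exact: lt_le_trans s1.
have [K K0 HK] := exists_fast_jobs p s1 pj p0 psum.
(* The comparison schedule has only job 0 on the fast machine; its loads are [p_0 / s], 0 and the
   single small jobs, all at most [b]. *)
apply: (@max_jump_ratio_ge _ _ _ _ _ (fast_schedule K)
  (fast_schedule (pred1 ord0)) ord0) => //.
- by move=> i; rewrite /fast_speed; case: ifP.
- by move=> j; have [->|/pj/andP[]//] := eqVneq j ord0; exact: ltW.
- exact: jump_optimal_fast.
- apply: le_trans (load_le_makespan _ _ _ (lift ord0 ord0)).
  by rewrite load_slow (negbTE K0).
- apply: makespan_le => i; case: (unliftP ord0 i) => [j|] ->.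
    rewrite load_slow /=; case: eqVneq => [_|/pjb//].
    by apply: le_trans p0b; rewrite divr_ge0// ltW.
  by rewrite load_fast big_pred1_eq.
- exact: ltW.
Qed.

End OneFastMachine.

(** * Uniform laws on subintervals of the unit interval *)

Section UniformDensity.
Local Open Scope classical_set_scope.
Context {R : realType} {phi : R}.
Variables a b : R.
Hypotheses (a0 : 0 <= a) (ab : a < b) (b1 : b <= 1).
Hypothesis phi_ab : (b - a)^-1 <= phi.

(** Leaving out the left endpoint makes the lower bounds on job sizes strict, which separates small
    jobs from the big one even when [2 / phi] equals 1/2. *)
Definition uniform_fun (x : R) : R := (b - a)^-1 * \1_`]a, b] x.

Let unif_measurable : measurable_fun `[(0 : R), 1] uniform_fun.
Proof. by apply: measurable_funM => //; exact: measurable_indic. Qed.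

Let unif_bounds x : x \in `[0, 1]%R -> 0 <= uniform_fun x <= phi.
Proof.
move=> _; have c0 : 0 <= (b - a)^-1 by rewrite invr_ge0 subr_ge0 ltW.
rewrite /uniform_fun indicE; case: (_ \in _); rewrite ?mulr1 ?mulr0 ?c0//=.
by rewrite lexx (le_trans c0).
Qed.

Let integral_unif D : measurable D -> `]a, b] `<=` D ->
  (\int[lebesgue_measure]_(x in D) (uniform_fun x)%:E = 1)%E.
Proof.
move=> mD abD; rewrite /uniform_fun.
under eq_integral do rewrite EFinM.
rewrite ge0_integralZl//; last 2 first.
- by apply/measurable_EFinP; exact: measurable_indic.
- by rewrite lee_fin invr_ge0 subr_ge0 ltW.
rewrite integral_indic// setIidl//.
have ab_len : lebesgue_measure (`]a, b] : set R) = (b - a)%:E.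
  by rewrite lebesgue_measure_itv/= lte_fin ab -EFinD.
rewrite [X in (_ * X)%E](_ : _ = (b - a)%:E)//.
by rewrite -EFinM mulVf// subr_eq0 gt_eqF.
Qed.

Let ab01 : `]a, b] `<=` `[0, 1].
Proof.
move=> x /=; rewrite !in_itv/= => /andP[ax xb].
by rewrite (le_trans a0 (ltW ax)) (le_trans xb).
Qed.

Definition uniform_density : density phi :=
  Density unif_measurable unif_bounds (integral_unif _ (measurable_itv _) ab01).

Lemma uniform_density_prob : density_prob uniform_density `]a, b] = 1%E.
Proof.
rewrite /density_prob setIidl; last exact: ab01.
exact: integral_unif.
Qed.

End UniformDensity.

(** * From bounds of probability one to expectations *)

Section Expectation.
Context {d} {T : measurableType d} {R : realType}.
Import HBNNSimple.

(** The integral of a nonnegative function is a supremum over the simple functions below it; [a]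
    times the indicator of [A] is one of these, with integral [a]. Hence [X] may be any nonnegative
    function. *)
Lemma expectation_ge_cst (P : probability T R) (X : T -> R) (A : set T) (a : R) :
  measurable A -> P A = 1%E -> (forall x, 0 <= X x) -> 0 <= a ->
  (forall x, A x -> a <= X x) -> (a%:E <= 'E_P[X])%E.
Proof.
move=> mA PA X0 a0 AX; rewrite unlock ge0_integralE; last first.
  by move=> x _; rewrite lee_fin.
rewrite patch_setT; apply: ereal_sup_ubound => /=.
pose h := scale_nnsfun (indic_nnsfun R mA) a0.
exists h.
  move=> x; rewrite lee_fin /=.
  rewrite mindicE; have [/set_mem/AX|_] := boolP (x \in A).
    by rewrite mulr1.
  by rewrite mulr0.
rewrite sintegralrM sintegral_indic//.
by transitivity (a%:E * P A)%E => //; rewrite PA mule1.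
Qed.
End Expectation.

(** By independence the box of the [A j] has probability one. *)
Lemma tuple_prob_ge_cst {R : realType} {n} (mu : 'I_n -> probability R R)
    (X : n.-tuple R -> R) (A : 'I_n -> set R) (a : R) :
  (forall j, measurable (A j)) -> (forall j, mu j (A j) = 1%E) ->
  (forall p, 0 <= X p) -> 0 <= a ->
  (forall p, (forall j, A j (tnth p j)) -> a <= X p) ->
  (a%:E <= 'E_(tuple_prob mu)[X])%E.
Proof.
move=> mA muA X0 a0 AX.
apply: (@expectation_ge_cst _ _ _ _ _ [set p | forall j, A j (tnth p j)]%classic) => //.
- rewrite (_ : [set p | _] = \bigcap_(j in [set: 'I_n])
      ((fun p : n.-tuple R => tnth p j) @^-1` A j))%classic.
    apply: fin_bigcap_measurable => // j _; rewrite -[X in measurable X]setTI.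
    exact: measurable_tnth.
  by apply/seteqP; split => p /= Ap j; [move=> _|]; apply: Ap.
- by rewrite tuple_probE// big1.
Qed.

(** * The smooth instances *)

Lemma fast_speed_noninc {R : realType} (s : R) N (i i' : 'I_N.+2) :
  1 <= s -> (i <= i')%N -> fast_speed s i' <= fast_speed s i.
Proof.
move=> s1; rewrite /fast_speed; case: eqVneq => [->|_].
  by rewrite leqn0 => /eqP i0; case: eqVneq => // /eqP[]; exact: val_inj.
by case: ifP.
Qed.

Theorem theorem4 (R : realType) :
  exists c : R, 0 < c /\
    forall phi : R, 1 <= phi ->
      exists I : smooth_instance phi,
        ((c * phi)%:E <=
          'E_(processing_law I)[fun p => max_jump_ratio (si_speed I) p])%E.
Proof.
(* For [phi >= 4] the ratio is at least 1/2 divided by [2 / phi], that is [phi / 4]; for [phi < 4]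
   the target is below 1. *)
exists 4^-1; split; first by rewrite invr_gt0.
move=> phi phi1; have phi0 : 0 < phi by exact: lt_le_trans phi1.
have [phi4|phi4] := ltP phi 4.
  (* One job, uniform on []0, 1]], and two machines of speed 1: the general bound with [s = 1] and
     [b = p_0] gives 1. *)
  have phi_01 : (1 - 0)^-1 <= phi by rewrite subr0 invr1.
  pose f := uniform_density _ _ (lexx 0) ltr01 (lexx 1) phi_01.
  exists (@SmoothInstance R phi 1 (fast_speed 1)
    (fun i i' => @fast_speed_noninc R 1 0 i i' (lexx 1)) erefl 1 (fun=> f)).
  apply: (@tuple_prob_ge_cst _ _ _ _ (fun=> `]0, 1]%classic)) => //.
  - by move=> j; exact: uniform_density_prob.
  - by move=> p; exact: max_jump_ratio_ge0.
  - by rewrite mulr_ge0// ltW.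
  move=> p /(_ ord0) /=; rewrite in_itv/= => /andP[p0 _].
  have j0 (j : 'I_1) : j != ord0 -> False by rewrite ord1 eqxx.
  apply: (@le_trans _ _ (tnth p ord0 / tnth p ord0)).
    by rewrite divff ?gt_eqF//; lra.
  apply: (@max_jump_ratio_fast_ge _ 1 0) => //.
  - by move=> j /j0.
  - by rewrite subrr mul0r; apply: sumr_ge0 => j /j0.
  - by rewrite divr1.
  - by move=> j /j0.
have half_1 : (1 - 2^-1)^-1 <= phi :> R.
  by rewrite (_ : 1 - 2^-1 = 2^-1) ?invrK; lra.
(* The small jobs live on an interval of length [1 / phi], the shortest that a density bounded by
   [phi] allows. *)
have phiV : 2 / phi - phi^-1 = phi^-1 by lra.
have phi_small : (2 / phi - phi^-1)^-1 <= phi by rewrite phiV invrK.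
have small0 : 0 <= phi^-1 by rewrite invr_ge0 ltW.
have small_lt : phi^-1 < 2 / phi by rewrite -subr_gt0 phiV invr_gt0.
have small_half : 2 / phi <= 2^-1 by rewrite ler_pdivrMr//; lra.
have small1 : 2 / phi <= 1 by lra.
have half0 : 0 <= 2^-1 :> R by lra.
have half_lt1 : 2^-1 < 1 :> R by lra.
pose f := uniform_density _ _ half0 half_lt1 (lexx 1) half_1.
pose g := uniform_density _ _ small0 small_lt small1 phi_small.
(* More than [phi ^+ 2] small jobs, each above [1 / phi], have total work at least [phi], which
   exceeds [(phi - 1) * p_0] as [p_0 <= 1]. *)
pose N := Num.bound (phi ^+ 2).
have NE : phi ^+ 2 < N%:R by apply: archi_boundP; rewrite sqr_ge0.
exists (@SmoothInstance R phi N.+1 (fast_speed phi)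
  (fun i i' => @fast_speed_noninc R phi N i i' phi1) erefl N.+1
  (fun j => if j == ord0 then f else g)).
apply: (@tuple_prob_ge_cst _ _ _ _ (fun j : 'I_N.+1 =>
  if j == ord0 then `]2^-1, 1]%classic else `]phi^-1, 2 / phi]%classic)) => /=.
- by move=> j; case: ifP.
- by move=> j; case: ifP => _; exact: uniform_density_prob.
- by move=> p; exact: max_jump_ratio_ge0.
- by rewrite mulr_ge0// ltW.
move=> p pA.
have [p0 p0_1] : 2^-1 < tnth p ord0 /\ tnth p ord0 <= 1.
  by have /= := pA ord0; rewrite in_itv/= => /andP.
have pj j : j != ord0 -> phi^-1 < tnth p j /\ tnth p j <= 2 / phi.
  by move=> /negbTE j0; have /= := pA j; rewrite j0 /= in_itv/= => /andP.
apply: (@le_trans _ _ (tnth p ord0 / (2 / phi))).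
  by rewrite invf_div mulrA; nra.
apply: max_jump_ratio_fast_ge => //.
- by lra.
- by move=> j /pj; lra.
- apply: (@le_trans _ _ (\sum_(j < N.+1 | j != ord0) phi^-1)); last first.
    by apply: ler_sum => j /pj[/ltW].
  rewrite sumr_const cardC1 card_ord /= -mulr_natl.
  apply: (@le_trans _ _ phi); first by nra.
  by rewrite ler_pdivlMr// -expr2 ltW.
- by rewrite ler_pM2r ?invr_gt0//; lra.
- by move=> j /pj[].
Qed.
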